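(* Let $c\ge1$ and let $\Omega\subset\mathbb{R}^n$ be a bounded $c$-John domain. If there is a constant $b=b(c)\ge 1$ such that every quasihyperbolic geodesic in $\Omega$ is a $b$-cone arc, then $\Omega$ is a QH-visibility domain.
   Context: For a domain $\Omega\subsetneq\mathbb{R}^n$, $\partial_{Euc}\Omega$ is its Euclidean boundary and $\delta_\Omega(x)=d_{Euc}(x,\partial_{Euc}\Omega)$. The quasihyperbolic metric is $k_\Omega(x,y)=\inf_\gamma\int_\gamma\frac{|dx|}{\delta_\Omega(x)}$, the infimum over rectifiable curves in $\Omega$ joining $x$ and $y$; a quasihyperbolic geodesic is a geodesic of $(\Omega,k_\Omega)$. Let $l$ denote Euclidean arc length, and $\gamma[x,z]$ the part of an arc $\gamma$ between $x$ and $z$. A rectifiable arc $\gamma\subset\Omega$ with endpoints $x,y$ is a $b$-cone arc if $\min\{l(\gamma[x,z]),l(\gamma[z,y])\}\le b\,\delta_\Omega(z)$ for all $z\in\gamma$. The domain $\Omega$ is a $c$-John domain if every pair of points $x,y\in\Omega$ can be joined by a rectifiable arc $\gamma$ in $\Omega$ that is a $c$-cone arc in this sense. A bounded domain $\Omega$ is a QH-visibility domain if for every pair $p,q\in\partial_{Euc}\Omega$, $p\neq q$, there exist neighborhoods $U$ of $p$ and $V$ of $q$ in $\mathbb{R}^n$ with $\overline U\cap\overline V=\emptyset$ and a compact set $K\subset\Omega$ such that every quasihyperbolic geodesic $\gamma:[0,T]\to\Omega$ with $\gamma(0)\in U$ and $\gamma(T)\in V$ satisfies $\gamma([0,T])\cap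 K\neq\emptyset$. *)

(* Defs.v *)
From HB Require Import structures.
From mathcomp Require Import all_boot all_order all_algebra.
From mathcomp Require Import all_classical all_reals all_analysis.

Set Implicit Arguments.
Unset Strict Implicit.
Unset Printing Implicit Defensive.

Import Order.TTheory GRing.Theory Num.Theory.
Import numFieldNormedType.Exports.

Local Open Scope classical_set_scope.
Local Open Scope ring_scope.

(* The norm of 'rV[R]_n in the library is the sup norm.  It induces the usual  *)
(* topology and the usual bounded sets of R^n, so the library notions of open, *)
(* closure, compact, continuous, bounded are used as they are; every metric    *)
(* quantity below (distance, length) is computed with the Euclidean distance.  *)

Section Curves.
Context {R : realType} {n : nat}.
Implicit Types (Omega A : set 'rV[R]_n) (x y : 'rV[R]_n)
  (a b c t s : R) (g : R -> 'rV[R]_n).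

Definition eucl_dist x y : R := Num.sqrt (\sum_(i < n) (x 0 i - y 0 i) ^+ 2).

Definition boundary A : set 'rV[R]_n := closure A `\` A°.

Definition domain Omega : Prop :=
  [/\ open Omega, Omega !=set0 & connected Omega].

Definition bdist Omega x : R := inf [set eucl_dist x y | y in boundary Omega].

(* Curves are parametrized: only the restriction of g to [a, b] matters, and   *)
(* a = b (a constant curve) is allowed.                                        *)
Definition curve_in Omega a b g : Prop :=
  [/\ a <= b, {within `[a, b], continuous g} & g @` `[a, b] `<=` Omega].

Definition polygonal_length a b g (p : seq R) : R :=
  \sum_(0 <= i < size p)
    eucl_dist (g (nth b (a :: p) i)) (g (nth b (a :: p) i.+1)).

Definition curve_length a b g : \bar R :=
  ereal_sup [set (polygonal_length a b g p)%:E | p in itv_partition a b].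

Definition rectifiable_in Omega a b g : Prop :=
  curve_in Omega a b g /\ (curve_length a b g < +oo)%E.

Definition arc_in Omega a b g : Prop :=
  rectifiable_in Omega a b g /\ {in `[a, b] &, injective g}.

(* Arc length parametrization of a rectifiable curve: for s between 0 and the  *)
(* length of g on [a, b], the point of g at arc length s from g a (the length  *)
(* of g on [a, t] is continuous and nondecreasing in t, so that the infimum is *)
(* the first t at which it equals s).                                          *)
Definition arclength_param a b g s : 'rV[R]_n :=
  g (inf [set t | t \in `[a, b] /\ (s%:E <= curve_length a t g)%E]).

Definition line_integral (f : 'rV[R]_n -> R) a b g : \bar R :=
  (\int[@lebesgue_measure R]_(s in `[0%R, fine (curve_length a b g)])
     (f (arclength_param a b g s))%:E)%E.

Definition qh_dist Omega x y : \bar R :=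
  ereal_inf [set l | exists a b g,
    [/\ rectifiable_in Omega a b g, g a = x, g b = y
      & l = line_integral (fun z => (bdist Omega z)^-1) a b g]].

Definition qh_geodesic Omega (T : R) g : Prop :=
  [/\ 0 <= T, g @` `[0, T] `<=` Omega
    & {in `[0, T] &, forall s t, qh_dist Omega (g s) (g t) = `|s - t|%:E}].

Definition cone_arc Omega c a b g : Prop :=
  arc_in Omega a b g /\
  forall t, t \in `[a, b] ->
    (mine (curve_length a t g) (curve_length t b g)
       <= (c * bdist Omega (g t))%:E)%E.

Definition john_domain Omega c : Prop :=
  domain Omega /\
  forall x y, Omega x -> Omega y ->
    exists a b g, [/\ cone_arc Omega c a b g, g a = x & g b = y].

Definition qh_visibility_domain Omega : Prop :=
  [/\ domain Omega, bounded_set Omega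
    & forall p q, boundary Omega p -> boundary Omega q -> p <> q ->
      exists U V K : set 'rV[R]_n,
        [/\ nbhs p U, nbhs q V, closure U `&` closure V = set0,
            compact K /\ K `<=` Omega
          & forall (T : R) g, qh_geodesic Omega T g -> U (g 0) -> V (g T) ->
              (g @` `[0, T]) `&` K !=set0]].

End Curves.

(* Main.v *)
Require Import Defs.
From HB Require Import structures.
From mathcomp Require Import all_boot all_order all_algebra.
From mathcomp Require Import all_classical all_reals all_analysis.
From mathcomp Require Import lra.
Import Order.TTheory GRing.Theory Num.Theory.
Import numFieldNormedType.Exports.
Local Open Scope classical_set_scope.
Local Open Scope ring_scope.

(** A cone arc cannot stay close to the boundary unless it is short.  Every
    curve from near [p] to near [q] has a point [z] at which both of its halves
    are long, because each half has to travel from an endpoint to [z]; the cone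
    condition at [z] then bounds the distance from [z] to the boundary from
    below.  All such curves therefore meet the part of the domain lying at a
    fixed positive distance from the boundary, which is compact when the domain
    is bounded.

    It is enough to watch one coordinate [i] in which [p] and [q] differ.  With
    [D = |p_i - q_i|], the neighborhoods [U] and [V] are the slabs of points
    whose [i]-th coordinate is within [D / 4] of that of [p], respectively [q],
    and [z] is a point whose [i]-th coordinate is the midpoint of [p_i] and
    [q_i], so that both halves have length at least [D / 4] and the distance
    from [z] to the boundary is at least [D / (4 b)].  The cone condition is
    exploited in [cone_arc_reaches_depth], and the compactness of the deep part
    is [inner_core_compact]. *)

Lemma coord_le_eucl_dist (R : realType) (n : nat) (x y : 'rV[R]_n) (i : 'I_n) :
  `|x 0 i - y 0 i| <= eucl_dist x y.
Proof.
rewrite -sqrtr_sqr /eucl_dist ler_sqrt; last first.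
  by apply: sumr_ge0 => j _; exact: sqr_ge0.
by rewrite (bigD1 i) //= lerDl sumr_ge0 // => j _; exact: sqr_ge0.
Qed.

Lemma eucl_distxx (R : realType) (n : nat) (x : 'rV[R]_n) : eucl_dist x x = 0.
Proof.
by rewrite /eucl_dist big1 ?sqrtr0 // => i _; rewrite subrr expr0n.
Qed.

Lemma continuous_bigsum (R : realType) (T : topologicalType) (I : Type)
    (s : seq I) (f : I -> T -> R) :
  (forall i, continuous (f i)) -> continuous (fun x => \sum_(i <- s) f i x).
Proof.
move=> f_cont x; elim: s => [|i s IHs].
  have -> : (fun x => \sum_(i <- [::]) f i x) = (fun=> 0).
    by apply/funext => z; rewrite big_nil.
  exact: cvg_cst.
have -> : (fun x => \sum_(j <- i :: s) f j x) =
    (fun x => f i x + \sum_(j <- s) f j x).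
  by apply/funext => z; rewrite big_cons.
by apply: continuousD; first exact: f_cont.
Qed.

Lemma eucl_dist_continuous (R : realType) (n : nat) (y : 'rV[R]_n) :
  continuous (fun x => eucl_dist x y).
Proof.
move=> x.
apply: (@continuous_comp _ _ _
  (fun x : 'rV[R]_n => \sum_(i < n) (x 0 i - y 0 i) ^+ 2) Num.sqrt);
  last exact: sqrt_continuous.
apply: continuous_bigsum => i z.
have diff_cont : {for z, continuous (fun z : 'rV[R]_n => z 0 i - y 0 i)}.
  apply: continuousB; first exact: coord_continuous.
  exact: cst_continuous.
exact: (continuousM diff_cont diff_cont).
Qed.

Lemma eucl_dist_le_curve_length (R : realType) (n : nat) (a b : R)
    (g : R -> 'rV[R]_n) :
  a <= b -> ((eucl_dist (g a) (g b))%:E <= curve_length a b g)%E.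
Proof.
rewrite le_eqVlt => /predU1P[->|ltab]; apply: ereal_sup_ubound.
  exists [::]; first by split.
  by rewrite /polygonal_length big_nil eucl_distxx.
exists [:: b]; first by split => //=; rewrite ltab.
by rewrite /polygonal_length big_nat1.
Qed.

(** The distance is bounded below pointwise rather than through [bdist], and
    the closure is taken, so that closedness is immediate. *)
Definition inner_core {R : realType} {n : nat} (Omega : set 'rV[R]_n) (e : R) :
    set 'rV[R]_n :=
  closure Omega `&` \bigcap_(y in boundary Omega) [set x | e <= eucl_dist x y].

Lemma bounded_set_closure (R : realType) (n : nat) (A : set 'rV[R]_n) :
  bounded_set A -> bounded_set (closure A).
Proof.
move=> [M [Mreal boundA]]; exists M; split=> // N ltMN.
have closed_N : closed [set x : 'rV[R]_n | `|x| <= N].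
  apply: (@preimage_closed _ _ (fun x : 'rV[R]_n => `|x|) [set r | r <= N]).
    by move=> x _; exact: norm_continuous.
  exact: closed_le.
by move=> x /(closureS (boundA N ltMN)) /closed_N.
Qed.

Lemma inner_core_compact (R : realType) (n : nat) (Omega : set 'rV[R]_n)
  (e : R) :
  bounded_set Omega -> compact (inner_core Omega e).
Proof.
move=> Omega_bounded; apply: bounded_closed_compact.
  have [M [Mreal boundM]] := bounded_set_closure _ _ _ Omega_bounded.
  by exists M; split=> // N ltMN x [clx _]; exact: boundM N ltMN x clx.
apply: closedI; first exact: closed_closure.
apply: closed_bigI => y _.
apply: (@preimage_closed _ _ (fun x => eucl_dist x y) [set r | e <= r]).
  by move=> x _; exact: eucl_dist_continuous.
exact: closed_ge.
Qed.

(** A point of the closure outside an open set is a boundary point, hence at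
    distance 0 from the boundary. *)
Lemma inner_core_sub (R : realType) (n : nat) (Omega : set 'rV[R]_n) (e : R) :
  open Omega -> 0 < e -> inner_core Omega e `<=` Omega.
Proof.
move=> /interior_id Omega_open e_gt0 x [clx far_x].
apply: contrapT => notOx.
have /far_x /= : boundary Omega x by split; rewrite ?Omega_open.
by rewrite eucl_distxx leNgt e_gt0.
Qed.

Lemma inner_core_bdist (R : realType) (n : nat) (Omega : set 'rV[R]_n) (e : R)
  (x : 'rV[R]_n) :
  Omega x -> e <= bdist Omega x -> inner_core Omega e x.
Proof.
move=> Ox le_e; split; first exact: subset_closure.
move=> y bdy /=; apply: le_trans le_e _; apply: ge_inf; last by exists y.
by exists 0 => _ [z _ <-]; exact: sqrtr_ge0.
Qed.

(** By the intermediate value theorem the arc passes through the level [v] of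
    the [i]-th coordinate; both parts of the arc cut there join points whose
    [i]-th coordinates are at least [r] apart. *)
Lemma cone_arc_reaches_depth (R : realType) (n : nat) (Omega : set 'rV[R]_n)
    (c a b r v : R) (g : R -> 'rV[R]_n) (i : 'I_n) :
  cone_arc Omega c a b g ->
  Num.min (g a 0 i) (g b 0 i) <= v <= Num.max (g a 0 i) (g b 0 i) ->
  r <= `|g a 0 i - v| -> r <= `|v - g b 0 i| ->
  exists2 t, t \in `[a, b] & r <= c * bdist Omega (g t).
Proof.
move=> [[[[le_ab g_cont _] _] _] cone] v_between far_a far_b.
have gi_cont : {within `[a, b], continuous (fun t => g t 0 i)}.
  apply: (@within_continuous_comp _ _ _ _ g (fun x : 'rV[R]_n => x 0 i)) g_cont.
  by move=> x _; exact: coord_continuous.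
have [t tab gtv] := @IVT _ (fun t => g t 0 i) a b v le_ab gi_cont v_between.
exists t => //.
have /andP[le_at le_tb] : (a <= t) && (t <= b) by rewrite in_itv in tab.
rewrite -lee_fin; apply: le_trans (cone t tab).
rewrite le_min; apply/andP; split.
  apply: le_trans (eucl_dist_le_curve_length _ _ _ _ g le_at).
  by rewrite lee_fin (le_trans far_a)// -gtv coord_le_eucl_dist.
apply: le_trans (eucl_dist_le_curve_length _ _ _ _ g le_tb).
by rewrite lee_fin (le_trans far_b)// -gtv coord_le_eucl_dist.
Qed.

Lemma closure_coord_slab (R : realType) (n : nat) (i : 'I_n) (u r : R) :
  closure [set x : 'rV[R]_n | `|x 0 i - u| < r]
    `<=` [set x | `|x 0 i - u| <= r].
Proof.
have closed_slab : closed [set x : 'rV[R]_n | `|x 0 i - u| <= r].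
  apply: (@preimage_closed _ _ (fun x : 'rV[R]_n => `|x 0 i - u|)
    [set s | s <= r]); last exact: closed_le.
  move=> x _.
  apply: (@continuous_comp _ _ _ (fun x : 'rV[R]_n => x 0 i - u) Num.norm);
    last exact: norm_continuous.
  apply: continuousB; first exact: coord_continuous.
  exact: cst_continuous.
move=> x clx; apply: closed_slab; apply: closureS clx => y; exact: ltW.
Qed.

Lemma nbhs_coord_slab (R : realType) (n : nat) (i : 'I_n) (p : 'rV[R]_n)
    (r : R) :
  0 < r -> nbhs p [set x : 'rV[R]_n | `|x 0 i - p 0 i| < r].
Proof.
move=> r_gt0.
have : nbhs p ((fun x : 'rV[R]_n => x 0 i) @^-1` ball (p 0 i) r).
  by apply: coord_continuous; exact: nbhsx_ballx.
by apply: filterS => x; rewrite /ball /= distrC.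
Qed.

Theorem theorem2p4 (R : realType) (n : nat) (c : R) (Omega : set 'rV[R]_n)
  (c_ge1 : 1 <= c)
  (Omega_proper : Omega `<` setT)
  (Omega_bounded : bounded_set Omega)
  (Omega_john : john_domain Omega c)
  (geodesic_cone : exists2 b : R, 1 <= b &
     forall (T : R) (g : R -> 'rV[R]_n),
       qh_geodesic Omega T g -> cone_arc Omega b 0 T g) :
  qh_visibility_domain Omega.
Proof.
have [dom_Omega _] := Omega_john; have [open_Omega _ _] := dom_Omega.
have [b b_ge1 cone] := geodesic_cone.
have b_gt0 : 0 < b by exact: lt_le_trans b_ge1.
split=> // p q _ _ neq_pq.
have [i neq_i] : exists i, p 0 i != q 0 i.
  apply: contrapT => /forallNP eq_pq; apply: neq_pq; apply/rowP => i.
  by apply/eqP; apply: contrapT => /negP /eq_pq.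
pose D := `|p 0 i - q 0 i|.
have D_gt0 : 0 < D by rewrite normr_gt0 subr_eq0.
have r_gt0 : 0 < D / 4 by lra.
exists [set x | `|x 0 i - p 0 i| < D / 4], [set x | `|x 0 i - q 0 i| < D / 4],
  (inner_core Omega (D / 4 / b)); split.
- exact: nbhs_coord_slab.
- exact: nbhs_coord_slab.
- rewrite -subset0 => x [/closure_coord_slab /= near_p /closure_coord_slab /= near_q].
  have : D <= D / 4 + D / 4.
    rewrite /D (le_trans (ler_distD (x 0 i) _ _))// lerD// distrC//.
  lra.
- by split; [exact: inner_core_compact | apply: inner_core_sub; rewrite ?divr_gt0].
move=> T g geo_g /= near_p near_q.
have cone_g := cone T g geo_g; have [_ g_in _] := geo_g.
(* Opening the absolute values once, according to the order of the two
   coordinates, leaves linear conditions for the midpoint below. *)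
have dist_pq :
    [/\ D = q 0 i - p 0 i, g 0 0 i < p 0 i + D / 4 & q 0 i - D / 4 < g T 0 i] \/
    [/\ D = p 0 i - q 0 i, p 0 i - D / 4 < g 0 0 i & g T 0 i < q 0 i + D / 4].
  move: near_p near_q; rewrite !ltr_norml => /andP[? ?] /andP[? ?].
  have [le_pq|lt_qp] := leP (p 0 i) (q 0 i); [left|right]; split; try lra.
    by rewrite /D distrC ger0_norm // subr_ge0.
  by rewrite /D gtr0_norm // subr_gt0.
have [||| t tT deep] := @cone_arc_reaches_depth _ _ _ _ _ _ (D / 4)
    ((p 0 i + q 0 i) / 2) _ i cone_g.
- by rewrite ge_min le_max; case: dist_pq => [[]|[]] ? ? ?;
    apply/andP; split; apply/orP; (left; lra) || (right; lra).
- by rewrite ler_normr; case: dist_pq => [[]|[]] ? ? ?;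
    apply/orP; (left; lra) || (right; lra).
- by rewrite ler_normr; case: dist_pq => [[]|[]] ? ? ?;
    apply/orP; (left; lra) || (right; lra).
exists (g t); split; first by exists t.
apply: inner_core_bdist; first by apply: g_in; exists t.
by rewrite ler_pdivrMr // [X in _ <= X]mulrC.
Qed.
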